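(* Fix $n\ge 1$ and assume that $\frac{\alpha}{\mathsf p}+\frac{\gamma}{\mathsf q}=1$; set $\rho=\alpha/\mathsf p$. Then the generator $\mathscr L$ of half-line open ASEP and the operator $\mathscr D^{(n,\rho)}$ are dual with respect to $H(\eta,\vec x)=\prod_{i=1}^n Q_{x_i}(\eta)$, i.e. for every $\eta\in\{0,1\}^{\mathbb Z_{\ge 1}}$ and every $\vec x\in\mathbb W^n_{\ge 1}$, $$\mathscr L H(\eta,\vec x)=\mathscr D^{(n,\rho)}H(\eta,\vec x),$$ where $\mathscr L$ acts on the variable $\eta$ and $\mathscr D^{(n,\rho)}$ acts on the variable $\vec x$.
   Context: Parameters: real numbers $\mathsf p>\mathsf q>0$ and $\alpha,\gamma\ge 0$; $q:=\mathsf q/\mathsf p\in(0,1)$. Half-line open ASEP: the continuous time Markov process on $\{0,1\}^{\mathbb Z_{>0}}$ (occupation variables $\eta=(\eta_x)_{x\ge1}$) with generator $$\mathscr L f(\eta)=\alpha(1-\eta_1)\big(f(\eta^+)-f(\eta)\big)+\gamma\eta_1\big(f(\eta^-)-f(\eta)\big)+\sum_{x=1}^\infty\big(\mathsf p\,\eta_x(1-\eta_{x+1})+\mathsf q\,\eta_{x+1}(1-\eta_x)\big)\big(f(\eta^{x,x+1})-f(\eta)\big),$$ where $\eta^{x,x+1}$ is $\eta$ with the values $\eta_x,\eta_{x+1}$ exchanged, and $\eta^+$ (resp. $\eta^-$) is $\eta$ with $\eta_1$ set to $1$ (resp. $0$). The same formula is used to define $\mathscr L H(\cdot,\vec x)$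 (only finitely many terms of the sum are nonzero). $N_x(\eta)=\sum_{i=x}^{\infty}\eta_i$ and $Q_x(\eta)=q^{N_x(\eta)}$ (with $q^{\infty}=0$). $\mathbb W^n_{\ge 1}=\{\vec x\in\mathbb Z^n:1\le x_1<\dots<x_n\}$, and $\vec x_i^{\pm}=(x_1,\dots,x_i\pm1,\dots,x_n)$. For $f:\mathbb W^n_{\ge1}\to\mathbb R$, with the convention $x_{n+1}=+\infty$, $$\mathscr D^{(n,\rho)}f(\vec x)=\sum_{\substack{2\le i\le n\\ x_i-x_{i-1}>1}}\mathsf p\big(f(\vec x_i^-)-f(\vec x)\big)+\sum_{\substack{1\le i\le n\\ x_{i+1}-x_i>1}}\mathsf q\big(f(\vec x_i^+)-f(\vec x)\big)+\mathbf 1_{x_1>1}\,\mathsf p\big(f(\vec x_1^-)-f(\vec x)\big)-\mathbf 1_{x_1=1}(\mathsf p-\mathsf q)\rho f(\vec x).$$ *)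

(* Defs.v *)
(* MathComp-Analysis; the reals are an arbitrary R : realType. *)
From HB Require Import structures.
From mathcomp Require Export all_boot all_order all_algebra.
From mathcomp Require Export all_classical all_reals all_analysis.

Set Implicit Arguments.
Unset Strict Implicit.
Unset Printing Implicit Defensive.

Import Order.TTheory GRing.Theory Num.Theory.
Import numFieldNormedType.Exports.
Local Open Scope ring_scope.

(* Lattice sites are the natural numbers x >= 1, as in the usual numbering: the
   value of a configuration at 0 is never read by N, Q, bond_rate or generator. *)
Definition config := nat -> bool.

Definition set_first (b : bool) (eta : config) : config :=
  [eta eta with 1%N |-> b].

Definition exchange (x : nat) (eta : config) : config :=
  [eta eta with x |-> eta x.+1, x.+1 |-> eta x].

Definition N (R : realType) (x : nat) (eta : config) : \bar R :=
  (\sum_(x <= i <oo) ((eta i)%:R)%:E)%E.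

(* r ^ m for extended m, with r ^ oo = 0; only nonnegative m occur. *)
Definition pow_ext (R : realType) (r : R) (m : \bar R) : R :=
  if m is s%:E then r `^ s else 0.

Definition Q (R : realType) (r : R) (x : nat) (eta : config) : R :=
  pow_ext r (N R x eta).

Definition bond_rate (R : realType) (p q : R) (x : nat) (eta : config) : R :=
  p * (eta x)%:R * (1 - (eta x.+1)%:R) + q * (eta x.+1)%:R * (1 - (eta x)%:R).

(* The series over bonds is the limit in R of its partial sums; it is a finite
   sum when all but finitely many exchanges leave f unchanged at eta, which is
   the case for f = H(., x) below. *)
Definition generator (R : realType) (p q alpha gamma : R) (f : config -> R)
    (eta : config) : R :=
  alpha * (1 - (eta 1%N)%:R) * (f (set_first true eta) - f eta)
  + gamma * (eta 1%N)%:R * (f (set_first false eta) - f eta)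
  + limn (fun m : nat => \sum_(1 <= x < m)
      bond_rate p q x eta * (f (exchange x eta) - f eta)).

(* Particle positions x_1, ..., x_n are indexed from 0 by 'I_n. *)
Definition first_idx (n : nat) (hn : (0 < n)%N) : 'I_n := Ordinal hn.

Definition weyl (n : nat) (hn : (0 < n)%N) (x : {ffun 'I_n -> nat}) : Prop :=
  (1 <= x (first_idx hn))%N /\ forall i j : 'I_n, (i < j)%N -> (x i < x j)%N.

Definition shift_up (n : nat) (x : {ffun 'I_n -> nat}) (i : 'I_n) :
    {ffun 'I_n -> nat} :=
  [ffun j => if j == i then (x j).+1 else x j].

Definition shift_down (n : nat) (x : {ffun 'I_n -> nat}) (i : 'I_n) :
    {ffun 'I_n -> nat} :=
  [ffun j => if j == i then (x j).-1 else x j].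

(* For i not the first index: x_i - x_(i-1) > 1. *)
Definition left_gap (n : nat) (x : {ffun 'I_n -> nat}) (i : 'I_n) : bool :=
  [forall j : 'I_n, (j.+1 == i :> nat) ==> ((x j).+1 < x i)%N].

(* x_(i+1) - x_i > 1; vacuously true at the last index, i.e. x_(n+1) = +oo. *)
Definition right_gap (n : nat) (x : {ffun 'I_n -> nat}) (i : 'I_n) : bool :=
  [forall j : 'I_n, (j == i.+1 :> nat) ==> ((x i).+1 < x j)%N].

(* At x in the Weyl chamber, f enters with nonzero coefficient only at points
   of the Weyl chamber, so a total f represents a function on the chamber. *)
Definition dual_operator (R : realType) (n : nat) (hn : (0 < n)%N)
    (p q rho : R) (f : {ffun 'I_n -> nat} -> R) (x : {ffun 'I_n -> nat}) : R :=
  let i1 := first_idx hn in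
  \sum_(i < n | (0 < i)%N && left_gap x i) p * (f (shift_down x i) - f x)
  + \sum_(i < n | right_gap x i) q * (f (shift_up x i) - f x)
  + (1 < x i1)%N%:R * (p * (f (shift_down x i1) - f x))
  - (x i1 == 1%N)%:R * ((p - q) * rho * f x).

Definition H (R : realType) (r : R) (n : nat) (eta : config)
    (x : {ffun 'I_n -> nat}) : R :=
  \prod_(i < n) Q r (x i) eta.

(* Main.v *)
Require Import Defs.
From mathcomp Require Import ring zify.
Import Order.TTheory GRing.Theory Num.Theory.
Import numFieldNormedType.Exports.
Local Open Scope ring_scope.

(* Everything reduces to Q_k = r^(eta_k) Q_(k+1), which holds even when both
   sides vanish because there are infinitely many particles.  Exchanging the
   bond (k, k+1) changes only Q_(k+1), and with r = q/p its contribution to the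
   generator is p (Q_k - Q_(k+1)) + q (Q_(k+2) - Q_(k+1)): the generator acts as
   n dual particles that ignore exclusion.  Where x_(i+1) = x_i + 1 the two
   forbidden jumps contribute (Q_k - Q_(k+1)) (p Q_k - q Q_(k+1)) = 0 with
   k = x_i.  A particle at x_1 = 1 sees the reservoir, and Liggett's condition
   turns that term into q (Q_2 - Q_1) - (p - q) rho Q_1. *)

(** * One-site recursion for [Q] and the effect of local moves *)

Section QuantumVariables.
Context {R : realType}.
Implicit Types (r p q : R) (eta : config).

Lemma N_recl k eta : N R k eta = (((eta k)%:R)%:E + N R k.+1 eta)%E.
Proof.
rewrite /N (nneseries_split k 1) => [|i _]; last by rewrite lee_fin ler0n.
by rewrite addn1 big_nat1.
Qed.

Lemma eq_N k eta eta' :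
  (forall i, (k <= i)%N -> eta i = eta' i) -> N R k eta = N R k eta'.
Proof.
move=> eq_eta; apply/congr_lim/funext => m.
by apply: eq_big_nat => i /andP[le_ki _]; rewrite eq_eta.
Qed.

Lemma pow_ext_natD r (m : nat) (s : \bar R) :
  0 < r -> pow_ext r (m%:R%:E + s)%E = r ^+ m * pow_ext r s.
Proof.
move=> r_gt0; case: s => [s| |] /=; rewrite ?mulr0 //.
rewrite powRD; last by rewrite (gt_eqF r_gt0) implybT.
by rewrite powR_mulrn // ltW.
Qed.

Lemma Q_recl r k eta : 0 < r -> Q r k eta = r ^+ eta k * Q r k.+1 eta.
Proof. by move=> r_gt0; rewrite /Q N_recl pow_ext_natD. Qed.

Lemma eq_Q r k eta eta' :
  (forall i, (k <= i)%N -> eta i = eta' i) -> Q r k eta = Q r k eta'.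
Proof. by move=> /eq_N eqN; rewrite /Q eqN. Qed.

(** Sites beyond y+1 keep their values, and for k <= y both exchanged sites are counted, so their
    two factors merely commute. Only the count starting at y+1 separates them. Arguing by the
    recursion instead of by particle numbers covers infinitely many particles. *)
Lemma Q_exchange r y k eta : 0 < r ->
  Q r k (exchange y eta) =
    if k == y.+1 then r ^+ eta y * Q r y.+2 eta else Q r k eta.
Proof.
move=> r_gt0.
have exchE i : exchange y eta i =
  if i == y then eta y.+1 else if i == y.+1 then eta y else eta i by [].
have far j : (y.+1 < j)%N -> Q r j (exchange y eta) = Q r j eta.
  by move=> lt_yj; apply: eq_Q => i le_ji; rewrite exchE !gtn_eqF //; lia.
have eY1 : exchange y eta y.+1 = eta y by rewrite exchE eqxx gtn_eqF.
have eY : exchange y eta y = eta y.+1 by rewrite exchE eqxx.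
have [->|ne_ky] := eqVneq k y.+1; first by rewrite Q_recl // eY1 far.
have [lt_yk|le_ky] := ltnP y k; first by apply: far; lia.
have Ey : Q r y (exchange y eta) = Q r y eta.
  rewrite Q_recl // (Q_recl _ y.+1) // eY eY1 far //.
  by rewrite [RHS]Q_recl // (Q_recl _ y.+1) // mulrCA.
rewrite -(subKn le_ky); elim: (y - k)%N => [|d IHd]; first by rewrite subn0.
(* Subtraction is truncated: once y <= d, both y - d and y - d.+1 are 0 and the induction hypothesis
   is the goal. *)
have [le_yd|lt_dy] := leqP y d.
  by move: IHd; rewrite (eqP le_yd) (_ : (y - d.+1)%N = 0)//; lia.
rewrite Q_recl // [RHS]Q_recl // subnSK // IHd.
by rewrite exchE !ltn_eqF //; lia.
Qed.

Lemma Q_set_first r b k eta : 0 < r -> (0 < k)%N ->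
  Q r k (set_first b eta) =
    if k == 1%N then r ^+ b * Q r 2 eta else Q r k eta.
Proof.
move=> r_gt0 k_gt0.
have far j : (1 < j)%N -> Q r j (set_first b eta) = Q r j eta.
  move=> lt_1j; apply: eq_Q => i le_ji.
  by rewrite /set_first [LHS]/= gtn_eqF //; apply: leq_trans le_ji.
have [->|ne_k1] := eqVneq k 1%N; first by rewrite Q_recl // far.
by apply: far; lia.
Qed.

Lemma bond_duality p q y eta : 0 < p -> 0 < q ->
  bond_rate p q y eta
    * (Q (q / p) y.+1 (exchange y eta) - Q (q / p) y.+1 eta)
  = p * (Q (q / p) y eta - Q (q / p) y.+1 eta)
    + q * (Q (q / p) y.+2 eta - Q (q / p) y.+1 eta).
Proof.
move=> p_gt0 q_gt0; have r_gt0 : 0 < q / p by rewrite divr_gt0.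
have p_neq0 : p != 0 by rewrite gt_eqF.
rewrite Q_exchange // eqxx (Q_recl _ y) // (Q_recl _ y.+1) // /bond_rate.
(* Every term is now a multiple of Q_(y+2), so four occupation patterns remain. *)
by case: (eta y) (eta y.+1) => -[] /=; field.
Qed.

Lemma boundary_duality p q alpha gamma eta :
  0 < p -> 0 < q -> alpha / p + gamma / q = 1 ->
  alpha * (1 - (eta 1%N)%:R)
    * (Q (q / p) 1 (set_first true eta) - Q (q / p) 1 eta)
  + gamma * (eta 1%N)%:R
    * (Q (q / p) 1 (set_first false eta) - Q (q / p) 1 eta)
  = q * (Q (q / p) 2 eta - Q (q / p) 1 eta)
    - (p - q) * (alpha / p) * Q (q / p) 1 eta.
Proof.
move=> p_gt0 q_gt0 liggett; have r_gt0 : 0 < q / p by rewrite divr_gt0.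
have p_neq0 : p != 0 by rewrite gt_eqF.
have q_neq0 : q != 0 by rewrite gt_eqF.
(* Liggett's condition, solved for [gamma], is what settles the case of an occupied first site. *)
have -> : gamma = q * (1 - alpha / p).
  by rewrite -liggett addrC addKr mulrC divfK.
rewrite !Q_set_first // !eqxx (Q_recl _ 1) //.
by case: (eta 1%N) => /=; field.
Qed.

(** One factor vanishes: the first if site k is empty, the second if it is occupied, since then Q_k
    = (q/p) Q_(k+1). *)
Lemma exclusion_cancel p q k eta : 0 < p -> 0 < q ->
  (Q (q / p) k eta - Q (q / p) k.+1 eta)
    * (p * Q (q / p) k eta - q * Q (q / p) k.+1 eta) = 0.
Proof.
move=> p_gt0 q_gt0; have r_gt0 : 0 < q / p by rewrite divr_gt0.
have p_neq0 : p != 0 by rewrite gt_eqF.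
by rewrite (Q_recl _ k) //; case: (eta k) => /=; field.
Qed.

(** Each move affects at most one factor of [H]. Letting both arguments vary serves exchanges,
    reservoir updates and jumps of dual particles alike. *)
Lemma H_updateB r n (x x' : {ffun 'I_n -> nat}) eta eta' (i : 'I_n) :
  (forall j, j != i -> Q r (x' j) eta' = Q r (x j) eta) ->
  H r eta' x' - H r eta x =
    (Q r (x' i) eta' - Q r (x i) eta) * \prod_(j < n | j != i) Q r (x j) eta.
Proof.
move=> eqQ; rewrite /H (bigD1 i) //= [X in _ - X](bigD1 i) //=.
by rewrite (eq_bigr _ eqQ) mulrBl.
Qed.

Lemma H_shift_downB r n (x : {ffun 'I_n -> nat}) eta (i : 'I_n) :
  H r eta (shift_down x i) - H r eta x =
    (Q r (x i).-1 eta - Q r (x i) eta) * \prod_(j < n | j != i) Q r (x j) eta.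
Proof.
rewrite (@H_updateB _ _ _ _ _ _ i) ?ffunE ?eqxx // => j /negPf ne_ji.
by rewrite ffunE ne_ji.
Qed.

Lemma H_shift_upB r n (x : {ffun 'I_n -> nat}) eta (i : 'I_n) :
  H r eta (shift_up x i) - H r eta x =
    (Q r (x i).+1 eta - Q r (x i) eta) * \prod_(j < n | j != i) Q r (x j) eta.
Proof.
rewrite (@H_updateB _ _ _ _ _ _ i) ?ffunE ?eqxx // => j /negPf ne_ji.
by rewrite ffunE ne_ji.
Qed.

End QuantumVariables.

Section WeylChamber.
Context {n : nat} {hn : (0 < n)%N} {x : {ffun 'I_n -> nat}}.
Hypothesis hx : weyl hn x.

Lemma weyl_inj : injective x.
Proof.
case: hx => _ x_incr i j eq_x; apply/val_inj/eqP.
by case: ltngtP => // /x_incr; rewrite eq_x ltnn.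
Qed.

Lemma weyl_gt (i : 'I_n) : (i < x i)%N.
Proof.
case: hx => x1 x_incr; case: i => i lt_in; elim: i lt_in => [|i IHi] lt_in.
  by rewrite (_ : Ordinal lt_in = first_idx hn) //; apply: val_inj.
apply: leq_ltn_trans (IHi (ltnW lt_in)) _.
exact: (x_incr (Ordinal (ltnW lt_in)) (Ordinal lt_in)).
Qed.

Lemma weyl_gt1 (i : 'I_n) : i != first_idx hn -> (1 < x i)%N.
Proof.
move=> ne_i; apply: leq_trans (weyl_gt i).
by rewrite ltnS lt0n; apply: contra ne_i => /eqP i0; apply/eqP/val_inj.
Qed.

End WeylChamber.

(** * The generator as dual particles without exclusion, plus a reservoir term *)

Section Duality.
Context {R : realType} {n : nat} {hn : (0 < n)%N} {x : {ffun 'I_n -> nat}}.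
Context {p q : R} (eta : config).
Hypotheses (hx : weyl hn x) (p_gt0 : 0 < p) (q_gt0 : 0 < q).
Let r := q / p.
Let r_gt0 : 0 < r. Proof. exact: divr_gt0. Qed.
Let h (x' : {ffun 'I_n -> nat}) := H r eta x'.

(** Only Q_(y+1) feels the exchange, and by injectivity at most one dual particle sits at y+1. The
    indicators allow the sums over bonds and particles to be interchanged. *)
Lemma bond_exchangeB y :
  bond_rate p q y eta * (H r (exchange y eta) x - h x) =
  \sum_(i < n) (x i == y.+1)%:R
    * (p * (h (shift_down x i) - h x) + q * (h (shift_up x i) - h x)).
Proof.
have [[i /eqP xi]|no_i] := pselect (exists i, x i == y.+1).
  rewrite (bigD1 i) //= xi eqxx mul1r big1 ?addr0 => [|j ne_ji]; last first.
    by rewrite -xi (inj_eq (weyl_inj hx)) (negPf ne_ji) mul0r.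
  rewrite (@H_updateB _ _ _ x x _ _ i) => [|j ne_ji]; last first.
    by rewrite Q_exchange // -xi (inj_eq (weyl_inj hx)) (negPf ne_ji).
  rewrite /h H_shift_downB H_shift_upB xi mulrA bond_duality //=.
  by rewrite mulrDl !mulrA.
have ne_x i : (x i == y.+1) = false by apply/negP => xi; apply: no_i; exists i.
rewrite big1 => [|i _]; last by rewrite ne_x mul0r.
rewrite /h /H (eq_bigr (fun i => Q r (x i) eta)) ?subrr ?mulr0 // => i _.
by rewrite Q_exchange // ne_x.
Qed.

Lemma bond_series :
  limn (fun m : nat => \sum_(1 <= y < m)
      bond_rate p q y eta * (H r (exchange y eta) x - h x))
  = \sum_(i < n) (1 < x i)%N%:R
      * (p * (h (shift_down x i) - h x) + q * (h (shift_up x i) - h x)).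
Proof.
(* Particle i is met only by bond x_i - 1, so the partial sums are constant from m = max x_i on. *)
apply: lim_near_cst => //; exists (\max_(i < n) x i)%N => // m /= le_xm.
under eq_bigr => y _ do rewrite bond_exchangeB.
rewrite exchange_big /=; apply: eq_bigr => i _; rewrite -mulr_suml.
congr (_ * _).
have le_im : (x i <= m)%N by apply: leq_trans le_xm; apply: leq_bigmax.
(* Bonds start at 1 and reach only sites y+1 >= 2, so a particle at site 1 gets no bulk term. *)
have [lt_1x|le_x1] := ltnP 1 (x i); last first.
  by rewrite big_nat big1 // => y /andP[y_gt0 _]; case: eqP => //; lia.
rewrite (bigD1_seq (x i).-1) ?mem_index_iota ?iota_uniq //=; last by lia.
rewrite prednK ?eqxx ?big1 ?addr0 //; last by lia.
move=> y ne_y; rewrite (_ : (x i == y.+1) = false) //.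
by apply: contraNF ne_y => /eqP ->.
Qed.

Lemma boundary_generator alpha gamma :
  alpha / p + gamma / q = 1 ->
  alpha * (1 - (eta 1%N)%:R) * (H r (set_first true eta) x - h x)
  + gamma * (eta 1%N)%:R * (H r (set_first false eta) x - h x)
  = (x (first_idx hn) == 1%N)%:R
    * (q * (h (shift_up x (first_idx hn)) - h x) - (p - q) * (alpha / p) * h x).
Proof.
move=> liggett; set i1 := first_idx hn.
have x_gt0 j : (0 < x j)%N by apply: leq_trans (weyl_gt hx j).
have [x1|ne_x1] := eqVneq (x i1) 1%N; last first.
  have Hset b : H r (set_first b eta) x = h x.
    apply: eq_bigr => j _; rewrite Q_set_first // ifN_eq //.
    have [->//|ne_j1] := eqVneq j i1.
    by rewrite gtn_eqF // (weyl_gt1 hx).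
  by rewrite !Hset subrr !mulr0 addr0 mul0r.
have HsetB b : H r (set_first b eta) x - h x =
    (Q r 1 (set_first b eta) - Q r 1 eta)
    * \prod_(j < n | j != i1) Q r (x j) eta.
  rewrite (@H_updateB _ _ _ x x _ _ i1) ?x1 // => j ne_j1.
  by rewrite Q_set_first // ifN_eq // gtn_eqF // (weyl_gt1 hx).
rewrite !HsetB !mulrA -mulrDl boundary_duality // /h H_shift_upB x1 mul1r.
have -> : H r eta x = Q r 1 eta * \prod_(j < n | j != i1) Q r (x j) eta.
  by rewrite /H (bigD1 i1) //= x1.
by rewrite mulrBl !mulrA.
Qed.

End Duality.

(** * Cancellation of the jumps forbidden by exclusion *)

Section ExcludedJumps.
Context {R : realType} {m : nat} {hm : (0 < m.+1)%N}.
Context {x : {ffun 'I_m.+1 -> nat}}.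
Context {p q : R} (eta : config).
Hypotheses (hx : weyl hm x) (p_gt0 : 0 < p) (q_gt0 : 0 < q).
Let h (x' : {ffun 'I_m.+1 -> nat}) := H (q / p) eta x'.

Lemma left_gapE (i j : 'I_m.+1) :
  j.+1 = i -> left_gap x i = ((x j).+1 < x i)%N.
Proof.
move=> eq_ij; apply/forallP/idP => [/(_ j)|lt_x k]; first by rewrite eq_ij eqxx.
by apply/implyP; rewrite -eq_ij eqSS => /eqP/val_inj ->.
Qed.

Lemma right_gapE (i j : 'I_m.+1) :
  j = i.+1 :> nat -> right_gap x i = ((x i).+1 < x j)%N.
Proof.
move=> eq_ji; apply/forallP/idP => [/(_ j)|lt_x k]; first by rewrite eq_ji eqxx.
by apply/implyP; rewrite -eq_ji => /eqP/val_inj ->.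
Qed.

Lemma right_gap_max : right_gap x ord_max.
Proof.
by apply/forallP => j; apply/implyP => /eqP /= eq_j; have := ltn_ord j; lia.
Qed.

(** Forbidden jumps come in pairs: x_(i+1) = x_i + 1 blocks the right jump of particle i and the
    left jump of particle i+1, and each pair reduces to [exclusion_cancel]. *)
Lemma excluded_jumps_cancel :
  \sum_(i < m.+1 | (0 < i)%N && ~~ left_gap x i) p * (h (shift_down x i) - h x)
  + \sum_(i < m.+1 | ~~ right_gap x i) q * (h (shift_up x i) - h x) = 0.
Proof.
(* Dropping the first index here and the last one in the other sum leaves both indexed by 'I_m,
   which aligns the neighbours [a] and [b]. *)
rewrite big_mkcond big_ord_recl /= add0r.
rewrite [X in _ + X]big_mkcond big_ord_recr /= right_gap_max addr0.
rewrite -big_split big1 //= => i _.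
set b := lift ord0 i; set a := widen_ord _ i.
have ab : a.+1 = b by [].
have ne_ab : a != b by apply/eqP => /(congr1 val); rewrite /= /bump; lia.
rewrite (left_gapE _ _ ab) (right_gapE _ _ (esym ab)).
case: ltnP => [_|le_xba] /=; first by rewrite addr0.
have xb : x b = (x a).+1.
  by case: hx => _ /(_ a b); rewrite -ab ltnSn => /(_ isT); lia.
(* Each product still contains the factor of the other neighbour; pulling it out leaves the common
   product [P]. *)
rewrite /h H_shift_downB H_shift_upB (bigD1 a) //=.
rewrite [X in q * (_ * X)](bigD1 b) /=;
  last by rewrite eq_sym.
under [X in q * (_ * (_ * X))]eq_bigl => j do rewrite andbC.
rewrite xb /=; set P := \prod_(_ < _ | _) _.
rewrite -[RHS](mulr0 P) -(exclusion_cancel _ _ (x a) eta p_gt0 q_gt0).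
by ring.
Qed.

End ExcludedJumps.

Theorem theorem2p4 (R : realType) (p q alpha gamma rho : R)
    (n : nat) (hn : (0 < n)%N)
    (hq : 0 < q) (hqp : q < p) (halpha : 0 <= alpha) (hgamma : 0 <= gamma)
    (hliggett : alpha / p + gamma / q = 1) (hrho : rho = alpha / p)
    (eta : config) (x : {ffun 'I_n -> nat}) (hx : weyl hn x) :
  generator p q alpha gamma (fun eta' => H (q / p) eta' x) eta
  = dual_operator hn p q rho (fun x' => H (q / p) eta x') x.
Proof.
have hp : 0 < p by apply: lt_trans hqp.
rewrite /generator boundary_generator // (bond_series eta hx hp hq) -hrho.
case: n hn x hx => // m hn x hx; rewrite /dual_operator.
set i1 := first_idx hn; set h := H _ _.
pose A i := p * (h (shift_down x i) - h x).
pose B i := q * (h (shift_up x i) - h x).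
have neq_i1 (i : 'I_m.+1) : (i != i1) = (0 < i)%N.
  by rewrite -(inj_eq val_inj) lt0n.
(* All particles but the first satisfy x_i > 1, so only the first keeps its indicator. *)
have -> : \sum_(i < m.+1) (1 < x i)%N%:R * (A i + B i) =
    (1 < x i1)%N%:R * (A i1 + B i1)
    + (\sum_(i < m.+1 | (0 < i)%N) A i + (\sum_(i < m.+1) B i - B i1)).
  rewrite (bigD1 i1) //= [in RHS](bigD1 i1 (F := B)) //= [B i1 + _]addrC addrK.
  rewrite -(eq_bigl _ _ neq_i1) -big_split /=; congr (_ + _).
  by apply: eq_bigr => i ne_i1; rewrite (weyl_gt1 hx) // mul1r.
rewrite (bigID (left_gap x) (fun i : 'I_m.+1 => (0 < i)%N)) /=.
rewrite (bigID (right_gap x) (fun=> true) B) /=.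
have /eqP := excluded_jumps_cancel eta hx hp hq; rewrite addr_eq0 => /eqP ->.
rewrite -/h -/(A i1) -/(B i1).
have x1_gt0 : (0 < x i1)%N := weyl_gt hx i1.
(* If x_1 = 1, the reservoir supplies the right jump [B i1] missing from the bulk; otherwise the
   bulk supplies both jumps of the first particle. *)
have [x1|ne_x1] := eqVneq (x i1) 1%N.
  by rewrite x1 /=; ring.
by rewrite ltn_neqAle eq_sym ne_x1 x1_gt0 /=; ring.
Qed.
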